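(* Let $k \ge 1$ be an integer and let $a_1,\dots,a_k$ be positive real numbers. Let $R$ be the set of $k$-tuples $(x_1,\dots,x_k)$ of real numbers satisfying $0<x_1<\cdots<x_k<1$. Then $$ \int_R \det\left(x_i^{a_j-1}\right)_{1\le i,j\le k}\, dx_1\cdots dx_k = \frac{\prod_{1\le i<j\le k}(a_j-a_i)}{\prod_{1\le i\le k} a_i\,\prod_{1\le i<j\le k}(a_j+a_i)}. $$
   Context: The matrix $\left(x_i^{a_j-1}\right)_{1\le i,j\le k}$ is the $k\times k$ matrix whose entry in row $i$ and column $j$ is $x_i^{a_j-1}$. Empty products are equal to $1$. *)

(* Defs.v *)
From HB Require Import structures.
From mathcomp Require Import all_boot all_order all_algebra.
From mathcomp Require Import all_classical all_reals all_analysis.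

Set Implicit Arguments.
Unset Strict Implicit.
Unset Printing Implicit Defensive.

Import Order.TTheory GRing.Theory Num.Theory.

Local Open Scope classical_set_scope.
Local Open Scope ring_scope.

Section lebesgue_tuple.
Variable R : realType.
Local Notation mR := (measurableTypeR R).

Definition pair_cons n (p : mR * n.-tuple mR) : n.+1.-tuple mR :=
  [tuple of p.1 :: p.2].

Lemma measurable_pair_cons n :
  measurable_fun [set: mR * n.-tuple mR] (@pair_cons n).
Proof. exact: measurable_cons. Qed.

Section lebesgue_cons.
Variables (n : nat) (mu : {sigma_finite_measure set (n.-tuple mR) -> \bar R}).

Definition lebesgue_cons : set (n.+1.-tuple mR) -> \bar R :=
  pushforward (@lebesgue_measure R \x mu)%E (@pair_cons n).

Let lebesgue_cons0 : lebesgue_cons set0 = 0%E.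
Proof. by rewrite /lebesgue_cons /pushforward preimage_set0 measure0. Qed.

Let lebesgue_cons_ge0 A : (0 <= lebesgue_cons A)%E.
Proof. exact: integral_ge0. Qed.

Let lebesgue_cons_sigma_additive : semi_sigma_additive lebesgue_cons.
Proof.
move=> F mF tF mUF; rewrite /lebesgue_cons /pushforward preimage_bigcup.
have mG A : measurable A -> measurable (@pair_cons n @^-1` A).
  by move=> mA; rewrite -[X in measurable X]setTI; exact: measurable_pair_cons.
apply: measure_semi_sigma_additive.
- by move=> i; exact: mG.
- apply/trivIsetP => /= i j _ _ ij; rewrite -preimage_setI.
  by move/trivIsetP : tF => /(_ _ _ _ _ ij) ->//; rewrite preimage_set0.
- by rewrite -preimage_bigcup; exact: mG.
Qed.

HB.instance Definition _ := isMeasure.Build _ _ _ lebesgue_cons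
  lebesgue_cons0 lebesgue_cons_ge0 lebesgue_cons_sigma_additive.

Let lebesgue_cons_sigma_finite : sigma_finite setT lebesgue_cons.
Proof.
have /sigma_finiteP[F [FT ndF Foo]] := sigma_finiteT (@lebesgue_measure R).
have /sigma_finiteP[G [GT ndG Goo]] := sigma_finiteT mu.
pose uncons (t : n.+1.-tuple mR) : mR * n.-tuple mR :=
  (thead t, [tuple of behead t]).
have m_uncons : measurable_fun setT uncons.
  apply/measurable_fun_pair; last exact: measurable_behead.
  exact: measurable_tnth.
exists (fun i => uncons @^-1` (F i `*` G i)) => [|i].
  apply/seteqP; split => // t _.
  have [i _ Fi] : (\bigcup_i F i) (thead t) by rewrite -FT.
  have [j _ Gj] : (\bigcup_i G i) [tuple of behead t] by rewrite -GT.
  exists (maxn i j) => //; split => /=.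
    by move: Fi; exact/subsetPset/ndF/leq_maxl.
  by move: Gj; exact/subsetPset/ndG/leq_maxr.
have [mF Fi] := Foo i; have [mG Gi] := Goo i.
have mFG : measurable (F i `*` G i) by exact: measurableX.
split; first by rewrite -[X in measurable X]setTI; exact: m_uncons.
rewrite /lebesgue_cons /pushforward -comp_preimage (_ : _ \o _ = idfun).
  by rewrite preimage_id product_measure1E// lte_mul_pinfty// ge0_fin_numE.
by apply/funext => -[x t]; congr pair; apply/val_inj.
Qed.

HB.instance Definition _ :=
  Measure_isSigmaFinite.Build _ _ _ lebesgue_cons lebesgue_cons_sigma_finite.

End lebesgue_cons.

(* Lebesgue measure on R^n, with R^n carried by n.-tuples and their product
   sigma-algebra: the image of lebesgue_measure \x lebesgue_tuple m under
   (x, t) |-> x :: t for n = m.+1, and the point mass on R^0.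
   lebesgue_tuple_box below is its characteristic property. *)
Fixpoint lebesgue_tuple n :
    {sigma_finite_measure set (n.-tuple mR) -> \bar R} :=
  if n is m.+1 return {sigma_finite_measure set (n.-tuple mR) -> \bar R}
  then lebesgue_cons (lebesgue_tuple m)
  else \d_([tuple] : 0.-tuple mR).

Lemma measurable_box n (A : 'I_n -> set mR) :
  (forall i, measurable (A i)) ->
  measurable [set t : n.-tuple mR | forall i, A i (tnth t i)].
Proof.
move=> mA; rewrite (_ : [set t | _] =
  \bigcap_(i in [set: 'I_n]) ((fun t : n.-tuple mR => tnth t i) @^-1` A i)).
  apply: fin_bigcap_measurable => // i _.
  by rewrite -[X in measurable X]setTI; exact: measurable_tnth.
by apply/seteqP; split=> t /= tA i; [move=> _|]; exact: tA.
Qed.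

Lemma lebesgue_tuple_box n (A : 'I_n -> set mR) :
  (forall i, measurable (A i)) ->
  lebesgue_tuple n [set t : n.-tuple mR | forall i, A i (tnth t i)] =
  (\prod_(i < n) lebesgue_measure (A i))%E.
Proof.
elim: n A => [|n IHn] A mA.
  by rewrite big_ord0 /= diracE mem_set//= => -[].
rewrite big_ord_recl -(IHn (fun i => A (lift ord0 i))) //.
rewrite -product_measure1E; last 2 first.
- exact: mA.
- apply: (@measurable_box n (fun i => A (lift ord0 i))) => i; exact: mA.
rewrite /= /lebesgue_cons /pushforward; congr (product_measure1 _ _ _).
apply/seteqP; split => -[x t] /= => [xt|[Ax At] i].
  split; first exact: (xt ord0).
  by move=> i; have := xt (lift ord0 i); rewrite tnthS.
case: (unliftP ord0 i) => [j ->|-> //]; by rewrite tnthS.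
Qed.

End lebesgue_tuple.

(* Main.v *)
Require Import Defs.
From mathcomp Require Import all_boot all_order all_algebra all_fingroup.
From mathcomp Require Import all_classical all_reals all_analysis.
From mathcomp Require Import measurable_realfun ring.

Import Order.TTheory GRing.Theory Num.Theory.
Import numFieldNormedType.Exports.

Local Open Scope classical_set_scope.
Local Open Scope ring_scope.

(** Expanding the determinant over permutations [s] turns the integrand into an
    alternating sum of monomials [\prod_i x_i ^ (a (s i) - 1)].  Each monomial
    is nonnegative, and integrating out the smallest variable first,
    [\int_0^(x_2) x_1 ^ (b_1 - 1) dx_1 = x_2 ^ b_1 / b_1], merges the first two
    exponents; by induction ([integral_chain_monomial]) its integral over the
    region is the product over [i] of [1 / (b_1 + ... + b_i)].  The integral of
    the determinant is therefore [alternating_sum a].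

    It remains to show [alternating_sum a = pair_quotient a], the right-hand
    side, when the [a_i] are distinct ([alternating_sumE]).  Splitting the
    permutations according to the image [m] of the last index, the largest
    partial sum is the total sum of the [a_i] and factors out
    ([alternating_sum_recr]).  Inductively the claim becomes
    [\sum_m a_m \prod_(i != m) (a_m + a_i) / (a_m - a_i) = \sum_m a_m], which
    is Lagrange interpolation of [\prod_j (X + a_j) - \prod_j (X - a_j)] at the
    points [a_m], read off at the top coefficient ([lagrange_sum_residues]).

    If two of the [a_i] coincide, the determinant has two equal columns and both
    sides vanish. *)

(** * The partial-sum identity over permutations *)

(** A permutation is determined by the image [m] of the last index together
    with the bijection induced between the remaining indices, and surjectivity
    of the reindexing follows from the count [n.+1`! = n.+1 * n`!]. *)
Lemma sum_lift_perm_max (V : nmodType) n (F : 'S_n.+1 -> V) :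
  \sum_(s : 'S_n.+1) F s =
  \sum_(m < n.+1) \sum_(t : 'S_n) F (lift_perm ord_max m t).
Proof.
rewrite pair_bigA /= (reindex (fun p => lift_perm ord_max p.1 p.2)) //.
apply/onW_bij/inj_card_bij; last first.
  by rewrite card_prod !card_Sn card_ord factS.
move=> [m t] [m' t'] /= e.
have mm : m = m' by rewrite -(lift_perm_id ord_max m t) e lift_perm_id.
move: e; rewrite -{}mm => e; congr pair; apply/permP => i.
by apply: (@lift_inj _ m); rewrite -!(lift_perm_lift ord_max m) e.
Qed.

Lemma lift_max_val n (i : 'I_n) : lift ord_max i = i :> nat.
Proof. by rewrite /= /bump leqNgt ltn_ord. Qed.

(** The pairs [i < j] containing [m] are separated from those that avoid it. *)
Lemma prod_pairs_lift (K : comNzRingType) n (g : 'I_n.+1 -> 'I_n.+1 -> K)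
    (m : 'I_n.+1) :
  \prod_(i < n.+1) \prod_(j < n.+1 | (i < j)%N) g i j =
  (\prod_(i < n) if (i < m)%N then g (lift m i) m else g m (lift m i)) *
  \prod_(i < n) \prod_(j < n | (i < j)%N) g (lift m i) (lift m j).
Proof.
rewrite (bigD1_ord m) //= big_mkcond (bigD1_ord m) //=.
rewrite ltnn mul1r.
under [X in _ * X]eq_bigr => i _.
  rewrite big_mkcond (bigD1_ord m) //=.
  under eq_bigr do rewrite ltnNge leq_bump2 -ltnNge.
  rewrite -big_mkcond /=; over.
rewrite /= big_split mulrA -big_split /=; congr (_ * _).
apply: eq_bigr => i _; rewrite /bump.
case: (ltnP i m) => im /=; first by rewrite add0n im ltnNge (ltnW im) mul1r.
by rewrite add1n ltnS im ltnNge (leqW im) mulr1.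
Qed.

(** The sign that the factors [a j - a i] with [m] among [i], [j] pick up when
    all of them are rewritten as [a m - _]. *)
Lemma prod_sign_ge (K : comNzRingType) n (m : 'I_n.+1) :
  \prod_(i < n) (if (i < m)%N then 1 else -1 : K) = (-1) ^+ (n + m).
Proof.
transitivity ((-1) ^+ (n - m) : K); last first.
  rewrite -[RHS]signr_odd oddD -(oddB (leq_ord m)).
  by rewrite signr_odd.
rewrite -(big_mkord predT (fun i => if (i < m)%N then 1 else -1 : K)).
rewrite (big_cat_nat (n := m)) //= ?leq_ord // big_nat big1 ?mul1r; last first.
  by move=> i /andP[_ ->].
rewrite big_nat (eq_bigr (fun=> -1)) -?big_nat ?prodr_const_nat // => i.
by case/andP; rewrite leqNgt => /negbTE ->.
Qed.

(** The polynomial [P - Q] with [P = \prod_j ('X + a j)] and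
    [Q = \prod_j ('X - a j)] has size at most [n.+1] and takes the value
    [P.[a m]] at [a m], so it equals its Lagrange interpolant at the [a m].  Its
    coefficient of degree [n] is twice the sum of the [a m]; the factor 2 also
    occurs in [P.[a m]], which contains [a m + a m]. *)
Lemma lagrange_sum_residues (K : numFieldType) n (a : 'I_n.+1 -> K) :
  injective a ->
  \sum_(m < n.+1)
    a m * \prod_(i < n) ((a m + a (lift m i)) / (a m - a (lift m i)))
  = \sum_(m < n.+1) a m.
Proof.
move=> inj_a.
pose P : {poly K} := \prod_(j < n.+1) ('X - (- a j)%:P).
pose Q : {poly K} := \prod_(j < n.+1) ('X - (a j)%:P).
pose L (m : 'I_n.+1) : {poly K} := \prod_(i < n) ('X - (a (lift m i))%:P).
pose c (m : 'I_n.+1) : K := \prod_(i < n) (a m - a (lift m i)).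
have c_neq0 m : c m != 0.
  by apply/prodf_neq0 => i _; rewrite subr_eq0 (inj_eq inj_a) neq_lift.
have PE x : P.[x] = \prod_(j < n.+1) (x + a j).
  by rewrite horner_prod; apply: eq_bigr => j _; rewrite hornerXsubC opprK.
have QE m : Q.[a m] = 0.
  by rewrite horner_prod (bigD1 m) //= hornerXsubC subrr mul0r.
have LE m m' : (L m).[a m'] = if m == m' then c m else 0.
  rewrite horner_prod; case: eqVneq => [<-|mm'].
    by apply: eq_bigr => i _; rewrite hornerXsubC.
  case: (unliftP m m') => [i Di|e]; last by rewrite e eqxx in mm'.
  by rewrite (bigD1 i) //= hornerXsubC Di subrr mul0r.
have interp : P - Q = \sum_(m < n.+1) (P.[a m] / c m) *: L m.
  apply/eqP; rewrite -subr_eq0; apply/eqP.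
  apply: (@roots_geq_poly_eq0 _ _ [seq a i | i <- enum 'I_n.+1]).
  - apply/allP => _ /mapP[m _ ->]; apply/rootP.
    rewrite hornerD hornerN hornerD hornerN QE subr0 horner_sum.
    rewrite (bigD1 m) //= big1 => [|m' /negbTE mm'].
      by rewrite hornerZ LE eqxx divfK // addr0 subrr.
    by rewrite hornerZ LE mm' mulr0.
  - by rewrite map_inj_uniq ?enum_uniq.
  rewrite size_map size_enum_ord; apply/leq_sizeP => j nj.
  rewrite coefB coefB coef_sum big1 ?subr0 => [|m _]; last first.
    rewrite coefZ nth_default ?mulr0 //.
    by rewrite size_prod_XsubC /index_enum -enumT size_enum_ord.
  have sz (b : 'I_n.+1 -> K) : size (\prod_(j < n.+1) ('X - (b j)%:P)) = n.+2.
    by rewrite size_prod_XsubC /index_enum -enumT size_enum_ord.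
  case: (ltngtP j n.+1) nj => // [nj|->] _.
    by rewrite !nth_default ?sz ?subr0.
  have lc (b : 'I_n.+1 -> K) : (\prod_(j < n.+1) ('X - (b j)%:P))`_n.+1 = 1.
    have /monicP := monic_prod_XsubC (index_enum 'I_n.+1) predT b.
    by rewrite /lead_coef sz.
  by rewrite !lc subrr.
have sub (b : 'I_n.+1 -> K) :
    (\prod_(j < n.+1) ('X - (b j)%:P))`_n = - \sum_(j < n.+1) b j.
  have /= := @coefPn_prod_XsubC _ [seq b i | i <- index_enum 'I_n.+1].
  rewrite size_map /index_enum -enumT size_enum_ord !big_map.
  by move=> H; apply: H.
have Ln m : (L m)`_n = 1.
  have /monicP := monic_prod_XsubC (index_enum 'I_n) predT (a \o lift m).
  rewrite /lead_coef size_prod_XsubC [size _](_ : _ = n) //.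
  by rewrite /index_enum -enumT size_enum_ord.
have two : (2 : K) != 0 by rewrite pnatr_eq0.
(* Compare the coefficients of degree n on both sides of interp. *)
apply: (mulfI two); move/(congr1 (fun p : {poly K} => p`_n)): interp.
rewrite coefB !sub coef_sum sumrN !opprK => sumE.
rewrite [RHS]mulr_natl [RHS]mulr2n sumE mulr_sumr.
apply: eq_bigr => m _; rewrite coefZ Ln mulr1 PE.
rewrite (bigD1_ord m) //= -mulr2n prodf_div.
by rewrite !mulrA mulr_natl.
Qed.

(** The signed sum of the integrals of the terms of the determinant: the inner
    factors are the inverses of [a (s 0) + ... + a (s i)]. *)
Definition alternating_sum {K : numFieldType} {n} (a : 'I_n -> K) : K :=
  \sum_(s : 'S_n) (-1) ^+ s *
    \prod_(i < n) (\sum_(j < n | (j <= i)%N) a (s j))^-1.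

Definition pair_quotient {K : numFieldType} {n} (a : 'I_n -> K) : K :=
  (\prod_(i < n) \prod_(j < n | (i < j)%N) (a j - a i)) /
  ((\prod_(i < n) a i) * \prod_(i < n) \prod_(j < n | (i < j)%N) (a j + a i)).

(** The factor of index [n] is the inverse of the full sum for every [s]; the
    other factors only involve the indices different from [m = s n]. *)
Lemma alternating_sum_recr (K : numFieldType) n (a : 'I_n.+1 -> K) :
  alternating_sum a = (\sum_m a m)^-1 *
    \sum_(m < n.+1) (-1) ^+ (n + m) * alternating_sum (a \o lift m).
Proof.
rewrite /alternating_sum sum_lift_perm_max mulr_sumr; apply: eq_bigr => m _.
rewrite mulr_sumr mulr_sumr; apply: eq_bigr => t _.
rewrite big_ord_recr /= odd_lift_perm /=.
have -> : \sum_(j < n.+1 | (j <= n)%N) a (lift_perm ord_max m t j) = \sum_j a j.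
  rewrite [RHS](reindex_inj (@perm_inj _ (lift_perm ord_max m t))).
  by apply: eq_bigl => j; rewrite leq_ord.
rewrite -oddD signr_addb signr_odd [RHS]mulrC !mulrA.
congr (_ * _ * _); apply: eq_bigr => i _; congr (_^-1).
rewrite big_mkcond big_ord_recr /= leqNgt ltn_ord addr0 -big_mkcond /=.
apply: eq_bigr => j _.
suff -> : widen_ord (leqnSn n) j = lift ord_max j by rewrite lift_perm_lift.
by apply: val_inj; rewrite /= -[RHS]/(nat_of_ord (lift ord_max j)) lift_max_val.
Qed.

(** Removing [a m] divides the quotient by the factors that contain it; up to
    the sign given by [prod_sign_ge] the inverse of their product is a summand
    of [lagrange_sum_residues]. *)
Lemma pair_quotient_lift (K : numFieldType) n (a : 'I_n.+1 -> K) (m : 'I_n.+1) :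
  injective a -> (forall i, 0 < a i) ->
  (-1) ^+ (n + m) * pair_quotient (a \o lift m) =
  pair_quotient a *
    (a m * \prod_(i < n) ((a m + a (lift m i)) / (a m - a (lift m i)))).
Proof.
move=> inj_a a_gt0; rewrite /pair_quotient !(prod_pairs_lift _ _ _ m).
rewrite (@bigD1_ord _ _ _ _ m predT a) //= prodf_div.
set V := \prod_(i < n) \prod_(j < n | (i < j)%N) (_ - _).
set S := \prod_(i < n) \prod_(j < n | (i < j)%N) (_ + _).
set A := \prod_(i < n) a _.
rewrite (_ : \prod_(i < n) (if (i < m)%N then a m + a (lift m i) else _) =
  \prod_(i < n) (a m + a (lift m i))); last first.
  by apply: eq_bigr => i _; case: ifP => // _; rewrite addrC.
rewrite (_ : \prod_(i < n) (if (i < m)%N then a m - a (lift m i) else _) =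
  (-1) ^+ (n + m) * \prod_(i < n) (a m - a (lift m i))); last first.
  rewrite -prod_sign_ge -big_split; apply: eq_bigr => i _ /=.
  by case: ifP => _; rewrite ?mul1r // mulN1r opprB.
set D := \prod_(i < n) (_ - _); set E := \prod_(i < n) (_ + _).
have D0 : D != 0.
  by apply/prodf_neq0 => i _; rewrite subr_eq0 (inj_eq inj_a) neq_lift.
have E0 : E != 0.
  by apply/prodf_neq0 => i _; rewrite gt_eqF // addr_gt0.
have A0 : A != 0 by apply/prodf_neq0 => i _; rewrite gt_eqF.
have S0 : S != 0.
  apply/prodf_neq0 => i _; apply/prodf_neq0 => j _.
  by rewrite gt_eqF // addr_gt0.
have am0 : a m != 0 by rewrite gt_eqF.
by field; rewrite D0 E0 A0 S0 am0.
Qed.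

Lemma alternating_sumE (K : numFieldType) n (a : 'I_n -> K) :
  injective a -> (forall i, 0 < a i) -> alternating_sum a = pair_quotient a.
Proof.
elim: n a => [|n IHn] a inj_a a_gt0.
  rewrite /alternating_sum /pair_quotient !big_ord0 mulr1 divr1.
  rewrite (eq_bigr (fun=> 1)) => [|s _]; last first.
    rewrite big_ord0 mulr1 (_ : s = 1%g) ?odd_perm1 //.
    by apply/permP => -[].
  by rewrite sumr_const card_Sn.
rewrite alternating_sum_recr.
have -> : \sum_(m < n.+1) (-1) ^+ (n + m) * alternating_sum (a \o lift m) =
    pair_quotient a * \sum_m a m.
  rewrite -(lagrange_sum_residues _ _ _ inj_a) mulr_sumr; apply: eq_bigr => m _.
  rewrite -pair_quotient_lift // IHn // => [|i]; last exact: a_gt0.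
  exact: inj_comp (@lift_inj _ m).
rewrite mulrCA mulVf ?mulr1 //.
by rewrite gt_eqF // big_ord_recl ltr_pwDl // sumr_ge0 // => i _; exact: ltW.
Qed.

(** * Integrals of monomials over ordered tuples *)

Lemma continuous_powR (R : realType) (s x : R) : 0 < x ->
  {for x, continuous (fun y : R => y `^ s)}.
Proof.
move=> x0; apply: differentiable_continuous; apply/derivable1_diffP.
by apply: derivable_powR; rewrite in_itv/= andbT.
Qed.

(** For [s < 1] the integrand is unbounded near 0, so the fundamental theorem of
    calculus is applied on [[y / n.+2, y]] and the intervals are exhausted by
    monotone convergence. *)
Lemma integral_powR (R : realType) (s y : R) : 0 < s -> 0 < y ->
  (\int[lebesgue_measure]_(x in `]0%R, y[) (x `^ (s - 1))%:E =
   (y `^ s / s)%:E)%E.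
Proof.
move=> s0 y0.
pose e n : R := y / n.+2%:R.
have e_gt0 n : 0 < e n by rewrite divr_gt0.
have e_lty n : e n < y by rewrite ltr_pdivrMr // ltr_pMr // ltr1n.
have ecvg : e n @[n --> \oo] --> (0 : R).
  rewrite -(mulr0 y); apply: cvgMr.
  by have := @cvg_harmonic R; rewrite -(cvg_shiftS (@harmonic R)).
have mf (A : set R) : measurable A ->
    measurable_fun A (EFin \o (fun x : R => x `^ (s - 1))).
  move=> mA; apply/measurable_EFinP.
  by apply: measurable_funTS; exact: measurable_powR.
have FTC n : (\int[lebesgue_measure]_(x in `[e n, y]) (x `^ (s - 1))%:E =
    (y `^ s / s - (e n) `^ s / s)%:E)%E.
  rewrite (@continuous_FTC2 _ _ (fun x => x `^ s / s)) //.
  - apply: continuous_in_subspaceT => x; rewrite inE/= in_itv/= => /andP[ex _].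
    exact/continuous_powR/(lt_le_trans (e_gt0 n)).
  - split.
    + move=> x; rewrite in_itv/= => /andP[ex _].
      apply: derivableM => //; apply: derivable_powR.
      by rewrite in_itv/= andbT (lt_trans (e_gt0 n)).
    + apply: cvg_at_right_filter; apply: cvgMl; exact/continuous_powR.
    + apply: cvg_at_left_filter; apply: cvgMl; exact/continuous_powR.
  - move=> x; rewrite in_itv/= => /andP[ex _].
    have x0 : 0 < x by exact: lt_trans ex.
    rewrite derive1E deriveM //; last first.
      by apply: derivable_powR; rewrite in_itv/= andbT.
    rewrite derive_cst scaler0 add0r.
    have [_ ->] := @is_derive1_powR R s x x0.
    by rewrite /GRing.scale /= mulrA mulVf ?mul1r // gt_eqF.
(* Adding the endpoint y, a null set, makes the interval the union of the
   segments on which FTC applies. *)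
rewrite -(@integral_itv_bndoo _ _ _ _ false false) //; last exact: mf.
have bigU : `]0%R, y]%classic = \bigcup_n `[e n, y]%classic.
  apply/seteqP; split=> [x /=|x [n _] /=]; rewrite !in_itv/=; last first.
    by move=> /andP[ex ->]; rewrite andbT (lt_le_trans _ ex).
  move=> /andP[x0 xy].
  have [n _ en] : \forall n \near \oo, e n < x by exact: (cvgr_lt _ ecvg).
  by exists n => //=; rewrite in_itv/= xy andbT ltW//; apply: en => /=.
rewrite bigU.
have ndF : nondecreasing_seq (fun n => `[e n, y]%classic).
  apply/nondecreasing_seqP => n; apply/subsetPset => x /=; rewrite !in_itv/=.
  move=> /andP[ex ->]; rewrite andbT (le_trans _ ex) //.
  by rewrite ler_pM2l // lef_pV2 ?posrE // ler_nat.
set I := (\int[_]_(x in _) _)%E.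
have cvgI : (\int[lebesgue_measure]_(x in `[e n, y]) (x `^ (s - 1))%:E)%E
    @[n --> \oo] --> I.
  apply: ge0_nondecreasing_set_cvg_integral => //.
  - by move=> n; exact: mf.
  - by move=> n x _; rewrite lee_fin powR_ge0.
apply: (cvg_unique _ cvgI) => //.
rewrite (_ : (fun _ => _) = (fun n => (y `^ s / s - (e n) `^ s / s)%:E)%E);
  last exact/funext.
apply: cvg_EFin; first by near=> n.
rewrite -[X in _ --> X]subr0; apply: cvgB; first exact: cvg_cst.
rewrite -(mul0r s^-1); apply: cvgMl.
by have /cvg_at_rightP := powR_cvg0 s0; apply.
Unshelve. all: by end_near. Qed.

Definition chain {R : realType} {n} (x : n.-tuple (measurableTypeR R)) : bool :=
  path (<%R : rel R) 0%R (rcons x 1%R).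

(** The monomial [\prod_i x_i ^ (b i - 1)] on the region, extended by 0.  The
    extra power [c] of the smallest coordinate carries the exponent accumulated
    by the variables already integrated out.  For the empty tuple that
    coordinate is read as the upper end 1 of the region. *)
Definition chain_monomial {R : realType} {n} (c : R) (b : 'I_n -> R)
    (x : n.-tuple (measurableTypeR R)) : R :=
  if chain x
  then (head 1 x : R) `^ c * \prod_(i < n) (tnth x i : R) `^ (b i - 1)
  else 0.

(** The smallest variable ranges over the interval from 0 to the next one, or to
    1 when it is the only one. *)
Lemma chain_cons (R : realType) n (x : measurableTypeR R)
    (t : n.-tuple (measurableTypeR R)) :
  chain [tuple of x :: t] = [&& (0 < x :> R), (x < head 1 t :> R) & chain t].
Proof.
rewrite /chain /=; case: t => -[|y s] /= _; first by rewrite ltr01 andbT.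
case: (ltP (0 : R) x) => //= x0; case: (ltP x y) => //= xy.
by rewrite (lt_trans x0 xy).
Qed.

Lemma measurable_head (R : realType) n :
  measurable_fun [set: n.-tuple (measurableTypeR R)] (fun x => head 1 x : R).
Proof.
case: n => [|n].
  rewrite (_ : (fun _ => _) = cst 1); first exact: measurable_cst.
  by apply/funext => x; rewrite tuple0.
rewrite (_ : (fun _ => _) = (fun x => tnth x ord0)).
  exact: measurable_tnth.
by apply/funext => x; rewrite (tnth_nth 1) nth0.
Qed.

Lemma measurable_chain (R : realType) n :
  measurable_fun [set: n.-tuple (measurableTypeR R)] chain.
Proof.
elim: n => [|n IHn].
  rewrite (_ : chain = cst true); first exact: measurable_cst.
  by apply/funext => x; rewrite tuple0 /chain /= ltr01.
rewrite (_ : chain = fun x => [&& (0 < thead x :> R),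
    (thead x < head 1 [tuple of behead x] :> R) & chain [tuple of behead x]]).
  have mh : measurable_fun [set: n.+1.-tuple (measurableTypeR R)] (@thead n _).
    exact: measurable_tnth.
  apply: measurable_and; first exact: measurable_fun_ltr.
  apply: measurable_and.
    apply: measurable_fun_ltr => //.
    exact: measurableT_comp (@measurable_head _ _) (@measurable_behead _ _ _).
  exact: measurableT_comp IHn (@measurable_behead _ _ _).
by apply/funext => x; rewrite -chain_cons; congr chain; exact: tuple_eta.
Qed.

Lemma measurable_chain_monomial (R : realType) n (c : R) (b : 'I_n -> R) :
  measurable_fun [set: n.-tuple (measurableTypeR R)] (chain_monomial c b).
Proof.
apply: measurable_fun_ifT; [exact: measurable_chain| |exact: measurable_cst].
apply: measurable_funM.
  exact: measurableT_comp (@measurable_powR _ c) (@measurable_head _ _).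
apply: measurable_prod => i _.
exact: measurableT_comp (@measurable_powR _ _) (@measurable_tnth _ _ _ _).
Qed.

Lemma chain_monomial_ge0 (R : realType) n (c : R) (b : 'I_n -> R) x :
  0 <= chain_monomial c b x.
Proof.
rewrite /chain_monomial; case: ifP => // _.
by rewrite mulr_ge0 ?powR_ge0 // prodr_ge0 // => i _; rewrite powR_ge0.
Qed.

Lemma chain_head_gt0 (R : realType) n (t : n.-tuple (measurableTypeR R)) :
  chain t -> 0 < (head 1 t : R).
Proof. by case: t => -[|y s] /= tP; rewrite /chain //= => /andP[]. Qed.

(** The exponent of the variable integrated out moves to the next one. *)
Lemma integral_chain_monomial_cons (R : realType) n (c : R) (b : 'I_n.+1 -> R)
    (t : n.-tuple (measurableTypeR R)) : 0 <= c -> 0 < b ord0 ->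
  (\int[lebesgue_measure]_x (chain_monomial c b [tuple of x :: t])%:E =
   ((c + b ord0)^-1 * chain_monomial (c + b ord0) (b \o lift ord0) t)%:E)%E.
Proof.
move=> c0 b0.
set V := \prod_(i < n) (tnth t i : R) `^ (b (lift ord0 i) - 1).
have [ct|/negbTE ct] := boolP (chain t); last first.
  rewrite {2}/chain_monomial ct mulr0 integral0_eq // => x _.
  by rewrite /chain_monomial chain_cons ct !andbF.
have V0 : 0 <= V by rewrite prodr_ge0 // => i _; rewrite powR_ge0.
rewrite {2}/chain_monomial ct -/V.
transitivity (\int[lebesgue_measure]_(x in `]0%R, (head 1%R t : R)[)
    (V%:E * (x `^ (c + b ord0 - 1))%:E))%E.
  rewrite [RHS]integral_mkcond; apply: eq_integral => x _.
  rewrite /chain_monomial chain_cons ct andbT patchE.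
  rewrite (_ : (x \in _) = ((0 < x :> R) && (x < head 1 t :> R))); last first.
    by apply/idP/idP; rewrite inE /= in_itv.
  case: ifPn => // /andP[x0 _]; rewrite big_ord_recl /= -EFinM mulrA.
  rewrite -powRD ?(gt_eqF x0) ?implybT // addrA mulrC; congr ((_ * _)%:E).
  by apply: eq_bigr => i _; rewrite tnthS.
rewrite ge0_integralZl_EFin //; last 2 first.
- by move=> x _; rewrite lee_fin powR_ge0.
- by apply/measurable_EFinP/measurable_funTS; exact: measurable_powR.
rewrite integral_powR ?ltr_wpDl ?chain_head_gt0 // -EFinM.
by congr (_%:E); rewrite mulrA mulrC [V * _]mulrC.
Qed.

(** Induction on [n], the smallest variable being innermost in Tonelli's
    theorem.  Letting [c] vary makes the exponent [c + b ord0] available for the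
    remaining variables. *)
Lemma integral_chain_monomial (R : realType) n (c : R) (b : 'I_n -> R) :
  0 <= c -> (forall i, 0 < b i) ->
  (\int[lebesgue_tuple R n]_x (chain_monomial c b x)%:E =
   (\prod_(i < n) (c + \sum_(j < n | (j <= i)%N) b j)^-1)%:E)%E.
Proof.
elim: n c b => [|n IHn] c b c0 b0.
  rewrite /= integral_dirac //; last first.
    by apply/measurable_EFinP; exact: measurable_chain_monomial.
  rewrite diracT mul1e /chain_monomial /chain /= ltr01 !big_ord0 mulr1.
  by rewrite powR1.
have mW := @measurable_chain_monomial R n.+1 c b.
rewrite /= /lebesgue_cons ge0_integral_pushforward //; last 3 first.
- exact: measurable_pair_cons.
- by apply/measurable_EFinP.
- by move=> x _; rewrite lee_fin chain_monomial_ge0.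
rewrite preimage_setT fubini_tonelli2 //=; last 2 first.
- apply: measurableT_comp (@measurable_pair_cons R n).
  by apply/measurable_EFinP.
- by move=> x; rewrite lee_fin chain_monomial_ge0.
rewrite /fubini_G.
under eq_integral => t _ do
  rewrite /= integral_chain_monomial_cons // EFinM.
have cb0 : 0 < c + b ord0 by rewrite ltr_wpDl.
rewrite ge0_integralZl_EFin ?invr_ge0 ?(ltW cb0) //; last 2 first.
- by move=> x _; rewrite lee_fin chain_monomial_ge0.
- by apply/measurable_EFinP; exact: measurable_chain_monomial.
rewrite IHn ?(ltW cb0) //; last by move=> i; exact: b0.
rewrite -EFinM; congr (_%:E).
rewrite big_ord_recl; congr (_ * _).
  by rewrite big_mkcond big_ord_recl /= big1 ?addr0.
apply: eq_bigr => i _; congr (_^-1).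
rewrite [in RHS]big_mkcond big_ord_recl /= -addrA; congr (_ + (_ + _)).
by rewrite -big_mkcond.
Qed.

(** * The integral of the determinant *)

Lemma integrable_chain_monomial (R : realType) n (b : 'I_n -> R) :
  (forall i, 0 < b i) ->
  (lebesgue_tuple R n).-integrable setT (EFin \o chain_monomial 0 b).
Proof.
move=> b0; apply/integrableP; split.
  by apply/measurable_EFinP; exact: measurable_chain_monomial.
under eq_integral => x _ do rewrite /= ger0_norm ?chain_monomial_ge0 //.
by rewrite integral_chain_monomial // ltry.
Qed.

Lemma det_powR_chain (R : realType) n (a : 'I_n -> R)
    (x : n.-tuple (measurableTypeR R)) :
  (if chain x
   then \det (\matrix_(i < n, j < n) (tnth x i : R) `^ (a j - 1)) else 0) =
  \sum_(s : 'S_n) (-1) ^+ s * chain_monomial 0 (a \o s) x.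
Proof.
rewrite /chain_monomial; case: ifP => cx; last first.
  by rewrite big1 // => s _; rewrite mulr0.
apply: eq_bigr => s _; rewrite powRr0 mul1r; congr (_ * _).
by apply: eq_bigr => i _; rewrite mxE.
Qed.

(** Each term of the Leibniz expansion is integrable over the region, so the
    integral may be exchanged with the sum over permutations. *)
Lemma integral_det_powR (R : realType) n (a : 'I_n -> R) :
  (forall i, 0 < a i) ->
  (\int[lebesgue_tuple R n]_(x in [set x | chain x])
     (\det (\matrix_(i < n, j < n) (tnth x i : R) `^ (a j - 1)))%R%:E =
   (alternating_sum a)%:E)%E.
Proof.
move=> a0; rewrite integral_mkcond.
have intM (s : 'S_n) : (lebesgue_tuple R n).-integrable setT
    (fun x => ((-1) ^+ s)%:E * (chain_monomial 0 (a \o s) x)%:E)%E.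
  apply: integrableZl => //.
  by apply: integrable_chain_monomial => i; exact: a0.
transitivity (\int[lebesgue_tuple R n]_x
    (\sum_(s : 'S_n) ((-1) ^+ s)%:E * (chain_monomial 0 (a \o s) x)%:E))%E.
  apply: eq_integral => x _; under eq_bigr do rewrite -EFinM.
  rewrite sumEFin -det_powR_chain patchE.
  by rewrite (_ : (x \in _) = chain x); [case: ifP|apply/idP/idP; rewrite inE].
rewrite integral_sum // -sumEFin; apply: eq_bigr => s _.
have as0 i : 0 < (a \o s) i by exact: a0.
rewrite integralZl //; last exact: integrable_chain_monomial.
rewrite integral_chain_monomial // -EFinM; congr ((_ * _)%:E).
by apply: eq_bigr => i _; rewrite add0r.
Qed.

Theorem mainTheorem1 (R : realType) (k : nat) (a : 'I_k -> R)
    (hk : (1 <= k)%N) (ha : forall i : 'I_k, 0 < a i) :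
  (\int[lebesgue_tuple R k]_(x in
      [set x : k.-tuple (measurableTypeR R) |
         path (<%R : rel R) 0%R (rcons x 1%R)])
     (\det (\matrix_(i < k, j < k) (tnth x i : R) `^ (a j - 1)))%R%:E)%E
  = ((\prod_(i < k) \prod_(j < k | (i < j)%N) (a j - a i))
     / ((\prod_(i < k) a i)
        * (\prod_(i < k) \prod_(j < k | (i < j)%N) (a j + a i))))%:E.
Proof.
have [/injectiveP inj_a|/injectivePn[i [j ij aij]]] := boolP (injectiveb a).
  rewrite -[RHS]/((pair_quotient a)%:E) -alternating_sumE //.
  by rewrite -integral_det_powR.
(* The factor a j - a i = 0 occurs in the numerator. *)
wlog lt_ij : i j ij aij / (i < j)%N.
  move=> H; case: (ltngtP i j) => [| |/val_inj e]; first exact: H.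
    by apply: H; rewrite // eq_sym.
  by rewrite e eqxx in ij.
rewrite (bigD1 i) //= (bigD1 j) //= aij subrr !mul0r integral0_eq // => x _.
rewrite -det_tr (determinant_alternate ij) // => m.
by rewrite !mxE aij.
Qed.
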